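(* Let $\boldsymbol w$ be a simplex weight vector and $\boldsymbol X$ a $[0,\infty)^m$-valued random vector. Let $I\subseteq[m]$, $|I|\ge2$, and let $r_I(t)\downarrow0$ as $t\to\infty$. Suppose $$r_I(t)^{-1}\Pr(\boldsymbol X_I/t\in\cdot)\xrightarrow{v}\nu_I(\cdot)\quad\text{on }(0,\infty]^I .\tag{a}$$ Assume that the discontinuity set of $G_I$ is $\nu_I$-null, that $\int|G_I|\,d\nu_I<\infty$, and that for $K_{\varepsilon,M}=\{\boldsymbol x_I:\varepsilon\le x_i\le M,\ i\in I\}$ one has $$\lim_{\varepsilon\downarrow0,\,M\uparrow\infty}\ \limsup_{t\to\infty}\ r_I(t)^{-1}\,\mathbb E\!\left[|G_I(\boldsymbol X_I/t)|\,\mathbf 1\{\boldsymbol X_I/t\notin K_{\varepsilon,M}\}\right]=0 .\tag{b}$$ Then $$\mathbb E\,G_I(\boldsymbol X_I/t)=r_I(t)\int G_I\,d\nu_I+o\{r_I(t)\}.$$ If these hypotheses (with face-specific $r_I$ and $\nu_I$) hold on every retained face $I$ (that is, for every $I$ in a chosen collection $\mathcal R$ of subsets of $[m]$ with $|I|\ge2$), and every omitted face ($|I|\ge2$, $I\notin\mathcal R$) satisfies $$\mathbb E|G_I(\boldsymbol X_I/t)|=o\{r(t)\},\tag{c}$$ then the exact face decomposition $\mathbf 1\{\boldsymbol w^{\mathsf T}\boldsymbol x>1\}=\sum_{\varnothing\ne I\subseteq[m]}G_I(\boldsymbol x_I)$, $\boldsymbol x\in[0,\infty)^m$, gives the expansion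 of the weighted-sum tail at target rate $r(t)$ by adding the retained face integrals: $$\Pr(\boldsymbol w^{\mathsf T}\boldsymbol X>t)=\sum_{i=1}^m\Pr(w_iX_i>t)+\sum_{I\in\mathcal R}r_I(t)\int G_I\,d\nu_I+o\{r(t)\}.$$ One sufficient route to (c) is that the same transfer and uniform-integrability hypotheses (the vague convergence (a), $\nu_I$-nullity of the discontinuity set of $G_I$, $\int|G_I|\,d\nu_I<\infty$, and (b)) hold on that omitted face together with $r_I(t)=o\{r(t)\}$; the nominal vague scale alone (that is, merely (a) with $r_I(t)=o\{r(t)\}$) is not sufficient.
   Context: $[m]=\{1,\dots,m\}$, $\boldsymbol x_I=(x_i)_{i\in I}$, $m$ fixed; simplex weights satisfy $w_i\ge0$, $\sum_i w_i=1$. All asymptotics are as $t\to\infty$. The $\nu_I$ are Radon measures on $(0,\infty]^I$, and $\xrightarrow{v}$ denotes vague convergence: convergence of integrals of continuous functions with compact support in $(0,\infty]^I$. For nonempty $I\subseteq[m]$ put $g_I(\boldsymbol x_I)=\mathbf 1\{\sum_{i\in I}w_ix_i>1\}$, $g_\varnothing=0$, and define the face increment $G_I(\boldsymbol x_I)=\sum_{J\subseteq I}(-1)^{|I|-|J|}g_J(\boldsymbol x_J)$. (Convention $0\cdot\infty=0$.)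
   Formalization: The tail expansion additionally assumes r_I(t) = O(r(t)) for every retained face I; without it the o(r_I) errors of the retained faces need not be o(r), and the stated expansion can fail. *)

(* Defs.v *)
From HB Require Import structures.
From mathcomp Require Import all_boot all_order all_algebra.
From mathcomp Require Import all_classical all_reals all_analysis.

Set Implicit Arguments.
Unset Strict Implicit.
Unset Printing Implicit Defensive.

Import Order.TTheory GRing.Theory Num.Theory.
Import numFieldNormedType.Exports.

Local Open Scope classical_set_scope.
Local Open Scope ring_scope.

(* Lets the Landau notations be used along [+oo]. *)
Canonical pinfty_nbhs_filter_on (R : numFieldType) :=
  FilterType (pinfty_nbhs R) (@filter_filter R _ proper_pinfty_nbhs).

Definition simplex_weight (R : realType) (m : nat) (w : 'I_m -> R) : Prop :=
  (forall i, 0 <= w i) /\ \sum_(i < m) w i = 1.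

(* [-oo, +oo]^I with the product topology. The points that matter are those of
   [0, +oo]^I: the limit measures live on (0, +oo]^I, but the increments are
   also evaluated at points having some coordinates equal to 0. *)
Notation extvec R I := (prod_topology (fun _ : {i | i \in I} => \bar R)).

Notation borel_extvec R I := (g_sigma_algebraType (@open (extvec R I))).

(* (0, +oo]^I: an open subset of [extvec R I], so that compactness of its
   subsets and continuity at its points may be read in [extvec R I]. *)
Definition posvec (R : realType) (m : nat) (I : {set 'I_m}) :
  set (extvec R I) := [set x | forall i, (0 < x i)%E].

Definition face (R : realType) (m : nat) (I : {set 'I_m}) (x : 'I_m -> R) :
  extvec R I := fun i => (x (val i))%:E.

Arguments posvec R {m} I.
Arguments face {R m} I x.

Definition extend0 (R : realType) (m : nat) (I : {set 'I_m})
  (x : extvec R I) (i : 'I_m) : \bar R :=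
  if insub i is Some j then x j else 0%E.

(* The convention 0 * +oo = 0 is the one of the product of \bar R. *)
Definition gface (R : realType) (m : nat) (w : 'I_m -> R) (J : {set 'I_m})
  (x : 'I_m -> \bar R) : R :=
  ((1 < \sum_(i in J) (w i)%:E * x i)%E)%:R.

(* Only subsets J of I occur, so the values chosen by [extend0] outside I are
   irrelevant. *)
Definition Gface (R : realType) (m : nat) (w : 'I_m -> R) (I : {set 'I_m})
  (x : extvec R I) : R :=
  \sum_(J : {set 'I_m} | J \subset I)
    (-1) ^+ (#|I| - #|J|) * gface w J (extend0 x).

Arguments Gface {R m} w I x.

Definition decreases_to0 (R : realType) (r : R -> R) : Prop :=
  [/\ \forall t \near +oo, 0 < r t,
      \forall s \near +oo, forall t, s <= t -> r t <= r s
    & r t @[t --> +oo] --> (0 : R)].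

(* A Radon measure on (0, +oo]^I is given as a Borel measure on [extvec R I] of
   which only the restriction to [posvec R I] is used. As (0, +oo]^I is locally
   compact and second countable, finiteness on compact sets implies
   regularity. *)
Definition radon_posvec (R : realType) (m : nat) (I : {set 'I_m})
  (nu : {measure set (borel_extvec R I) -> \bar R}) : Prop :=
  forall K : set (extvec R I),
    compact K -> K `<=` posvec R I -> (nu K < +oo)%E.

Definition scaled_face (R : realType) (m : nat) (d : measure_display)
  (T : measurableType d) (P : probability T R) (X : 'I_m -> {RV P >-> R})
  (I : {set 'I_m}) (t : R) (om : T) : extvec R I :=
  face I (fun i => X i om / t).

Arguments scaled_face {R m d T P} X I t om.

Definition vague_transfer (R : realType) (m : nat) (d : measure_display)
  (T : measurableType d) (P : probability T R) (X : 'I_m -> {RV P >-> R})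
  (I : {set 'I_m}) (r : R -> R)
  (nu : {measure set (borel_extvec R I) -> \bar R}) : Prop :=
  forall f : extvec R I -> R,
    continuous f ->
    (exists K : set (extvec R I),
      [/\ compact K, K `<=` posvec R I & forall x, ~ K x -> f x = 0]) ->
    (r t)^-1 * fine ('E_P[fun om => f (scaled_face X I t om)])
      @[t --> +oo] --> \int[nu]_(x in posvec R I) f x.

Definition box (R : realType) (m : nat) (I : {set 'I_m}) (eps M : R) :
  set (extvec R I) := [set x | forall i, (eps%:E <= x i <= M%:E)%E].

Arguments box {R m} I eps M.

Definition uniformly_integrable (R : realType) (m : nat)
  (d : measure_display) (T : measurableType d) (P : probability T R)
  (w : 'I_m -> R) (X : 'I_m -> {RV P >-> R}) (I : {set 'I_m}) (r : R -> R) :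
  Prop :=
  (* [p] is the pair (eps, M) *)
  limf_esup (fun t : R => ((r t)^-1)%:E *
      'E_P[(fun om => `|Gface w I (scaled_face X I t om)| *
                      \1_(~` box I p.1 p.2) (scaled_face X I t om))%R])%E +oo%R
    @[p --> filter_prod (0 : R)^'+ +oo%R] --> (0%E : \bar R).

Definition transfer_hyps (R : realType) (m : nat) (d : measure_display)
  (T : measurableType d) (P : probability T R) (w : 'I_m -> R)
  (X : 'I_m -> {RV P >-> R}) (I : {set 'I_m}) (r : R -> R)
  (nu : {measure set (borel_extvec R I) -> \bar R}) : Prop :=
  [/\ decreases_to0 r,
      radon_posvec nu /\ vague_transfer X r nu,
      nu.-negligible [set x | posvec R I x /\
        ~ {for (x : extvec R I), continuous (Gface w I)}],
      nu.-integrable (posvec R I) (EFin \o Gface w I)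
    & uniformly_integrable w X I r].

Definition mean_G (R : realType) (m : nat) (d : measure_display)
  (T : measurableType d) (P : probability T R) (w : 'I_m -> R)
  (X : 'I_m -> {RV P >-> R}) (I : {set 'I_m}) (t : R) : R :=
  fine ('E_P[fun om => Gface w I (scaled_face X I t om)]).

Definition mean_absG (R : realType) (m : nat) (d : measure_display)
  (T : measurableType d) (P : probability T R) (w : 'I_m -> R)
  (X : 'I_m -> {RV P >-> R}) (I : {set 'I_m}) (t : R) : R :=
  fine ('E_P[fun om => `|Gface w I (scaled_face X I t om)|]).

(* Main.v *)
Require Import Defs.
From mathcomp Require Import all_boot all_order all_algebra.
From mathcomp Require Import all_classical all_reals all_analysis.
From mathcomp Require Import measurable_realfun ring lra.

Set Implicit Arguments.
Unset Strict Implicit.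
Unset Printing Implicit Defensive.

Import Order.TTheory GRing.Theory Num.Theory.
Import numFieldNormedType.Exports.

Local Open Scope classical_set_scope.
Local Open Scope ring_scope.

(** The map [contract] embeds the extended line in [-1, 1], so the sum of the
    coordinatewise distances between contracted points metrizes [extvec R I].
    For a bounded [f] the infimal convolutions [inf_y (f y + k * dist x y)] are
    continuous, lie below [f] and converge to it at its continuity points.
    Multiplied by a continuous cutoff supported in a compact subset of
    (0, +oo]^I they are admissible in the vague convergence; applied to [f] and
    to [- f], they extend it to cutoffs of bounded functions that are almost
    everywhere continuous, in particular to [Gface]. Uniform integrability
    controls the part removed by the cutoff, which equals 1 on any given box
    [eps <= x_i <= M] once its index is large. The bound M plays no role, since
    the compact supports include points with infinite coordinates. The
    expansion of the tail then follows by Moebius inversion over the faces.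

    For the last claim all coordinates of X but one are constant: X / t leaves
    every compact subset of (0, +oo]^I, so the vague limit is zero at any rate,
    whereas [Gface] equals 1 when the remaining coordinate falls in an interval
    of length 1 at distance of order t. For an exponential coordinate this has
    exponentially small, but not negligible, probability. *)

(** * A metric on the extended cube *)

Section extvec_topology.
Context {R : realType} {m : nat} {I : {set 'I_m}}.
Local Notation E := (extvec R I).
Implicit Types (x y z : E) (e : R).

Definition cdist x y : R := \sum_i `|contract (x i) - contract (y i)|.

Lemma cdist_ge0 x y : 0 <= cdist x y.
Proof. exact: sumr_ge0. Qed.

Lemma cdist_refl x : cdist x x = 0.
Proof. by apply: big1 => i _; rewrite subrr normr0. Qed.

Lemma cdistC x y : cdist x y = cdist y x.
Proof. by apply: eq_bigr => i _; rewrite distrC. Qed.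

Lemma cdist_triangle x y z : cdist x z <= cdist x y + cdist y z.
Proof. by rewrite -big_split /=; apply: ler_sum => i _; exact: ler_distD. Qed.

Lemma le_cdist x y i : `|contract (x i) - contract (y i)| <= cdist x y.
Proof. by rewrite /cdist (bigD1 i)//= lerDl sumr_ge0. Qed.

(** The sum has [#|I|] terms, so dividing by [#|I|.+1] makes the inequality strict and stays
    meaningful when [I] is empty. *)
Lemma cdist_lt x y e : 0 < e ->
  (forall i, `|contract (x i) - contract (y i)| < e / (#|I|.+1)%:R) ->
  cdist x y < e.
Proof.
move=> e0 xy.
apply: (@le_lt_trans _ _ (\sum_(i : {i | i \in I}) e / (#|I|.+1)%:R)).
  by apply: ler_sum => i _; exact/ltW/xy.
rewrite sumr_const card_sig -[X in X < _]mulr_natr mulrAC ltr_pdivrMr//.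
by rewrite ltr_pM2l// ltr_nat.
Qed.

(** The balls of [\bar R] are by definition the preimages under [contract] of real balls. *)
Lemma contract_continuous : continuous (@contract R : \bar R -> R).
Proof.
move=> x; apply/cvgrPdist_lt => e e0.
suff : nbhs x [set y | `|contract x - contract y| < e] by [].
by apply/(@nbhs_ballP R); exists e.
Qed.

Lemma contract_proj_continuous i : continuous (fun x => contract (x i)).
Proof.
move=> x; apply: continuous_comp; last exact: contract_continuous.
exact: (@proj_continuous _ (fun _ : {i | i \in I} => \bar R)).
Qed.

(** A [cdist] ball contains a finite intersection of coordinate neighbourhoods. Conversely, the
    balls around [x] generate a filter that converges to [x] in every coordinate. *)
Lemma nbhs_cdist x (A : set E) :
  nbhs x A <-> exists2 e, 0 < e & forall y, cdist x y < e -> A y.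
Proof.
split=> [xA|[e e0 eA]]; last first.
  have cont i : \forall y \near x,
      `|contract (x i) - contract (y i)| < e / (#|I|.+1)%:R.
    have /cvgrPdist_lt := @contract_proj_continuous i x.
    by apply; rewrite divr_gt0.
  pose close i := [set y : E |
    `|contract (x i) - contract (y i)| < e / (#|I|.+1)%:R].
  have xclose := @filter_forall _ _ close _ (nbhs_filter x) cont.
  apply: (@filterS _ (nbhs x) (nbhs_filter x) _ _ _ xclose) => y xy; apply: eA.
  exact: cdist_lt.
pose F : set_system E := filter_from [set e : R | 0 < e]
                            (fun e => [set y | cdist x y < e]).
have FF : Filter F.
  apply: filter_from_filter; first by exists 1 => /=.
  move=> e1 e2 /= e10 e20; exists (Num.min e1 e2).
    by rewrite /= lt_min e10.
  by move=> y /=; rewrite lt_min => /andP.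
(* The product topology is the supremum of those induced by the projections, so convergence is
   checked coordinatewise; constant points show that the projections are surjective. *)
have /(_ A xA) : F --> x.
  apply/cvg_sup => i; apply/cvg_image.
    by rewrite eqEsubset; split => // y _; exists (fun _ => y).
  move=> B /nbhs_ballP[e /= e0 eB].
  exists ((fun y : E => y i) @^-1` B); last first.
    apply: image_preimage; rewrite eqEsubset.
    by split => // y _; exists (fun _ => y).
  exists e => // y /= xy; apply: eB; rewrite /ball /= /ereal_ball.
  exact: le_lt_trans (le_cdist _ _ _) xy.
by move=> [e /= e0 eA]; exists e.
Qed.

End extvec_topology.

(** * Lipschitz minorants of bounded functions *)

Section lipschitz_envelope.
Context {R : realType} {m : nat} {I : {set 'I_m}}.
Local Notation E := (extvec R I).
Implicit Types (x y : E) (f : E -> R) (k : R).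

Lemma cdist_lipschitz_continuous f k :
  (forall x y, f x - f y <= k * cdist x y) -> continuous f.
Proof.
move=> fk x; apply/(@cvgrPdist_lt _ _ _ (nbhs x) (nbhs_filter x)) => e e0.
(* The sign of [k] is arbitrary, so [k] is replaced by a positive upper bound by which one can
   divide. *)
have k1 : 0 < `|k| + 1 by rewrite ltr_wpDl.
apply/nbhs_cdist; exists (e / (`|k| + 1)); first exact: divr_gt0.
move=> y; rewrite ltr_pdivlMr// => xy /=.
have lekd z t : f z - f t <= cdist z t * (`|k| + 1).
  apply: le_trans (fk _ _) _; rewrite mulrC ler_wpM2l// ?cdist_ge0//.
  by apply: le_trans (ler_norm _) _; rewrite lerDl.
apply: le_lt_trans xy; rewrite ler_norml lekd andbT lerNl opprB.
by rewrite cdistC lekd.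
Qed.

Lemma continuous_measurable_extvec f :
  continuous f -> measurable_fun [set: borel_extvec R I] f.
Proof.
move=> /continuousP cf; apply: (measurability _ (RGenOpens.measurableE R)).
move=> _ [_ [a [b ->] <-]]; rewrite setTI.
by apply: sub_gen_smallest; exact/cf/interval_open.
Qed.

(** For [k >= 0] and bounded [f], this is the largest [k]-Lipschitz minorant of [f] (Pasch-Hausdorff
    envelope). *)
Definition lower_envelope f k x := inf (range (fun y => f y + k * cdist x y)).

Context (f : E -> R) (B : R).
Hypothesis fB : forall x, `|f x| <= B.

Lemma lower_envelope_lbound k x : 0 <= k ->
  lbound (range (fun y => f y + k * cdist x y)) (- B).
Proof.
move=> k0 _ [y _ <-]; rewrite ler_wpDr ?mulr_ge0 ?cdist_ge0//.
by have := fB y; rewrite ler_norml => /andP[].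
Qed.

Lemma lower_envelope_le_at k x y : 0 <= k ->
  lower_envelope f k x <= f y + k * cdist x y.
Proof.
move=> k0; apply: ge_inf; last by exists y.
by exists (- B); exact: lower_envelope_lbound.
Qed.

Lemma lower_envelope_le k x : 0 <= k -> lower_envelope f k x <= f x.
Proof.
by move=> /(@lower_envelope_le_at _ x x); rewrite cdist_refl mulr0 addr0.
Qed.

Lemma lower_envelope_norm_le k x : 0 <= k -> `|lower_envelope f k x| <= B.
Proof.
move=> k0; rewrite ler_norml (le_trans (lower_envelope_le _ _))//; last first.
  by have := fB x; rewrite ler_norml => /andP[].
rewrite andbT; apply: lb_le_inf; last exact: lower_envelope_lbound.
by exists (f x + k * cdist x x), x.
Qed.

(** By the triangle inequality, a point [z] competing in the infimum at [y] also competes at [x], at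
    an extra cost of at most [k * cdist x y]. *)
Lemma lower_envelope_continuous k : 0 <= k -> continuous (lower_envelope f k).
Proof.
move=> k0; apply: (@cdist_lipschitz_continuous _ k) => x y.
rewrite lerBlDr -lerBlDl.
apply: lb_le_inf => [|_ [z _ <-]]; first by exists (f y + k * cdist y y), y.
rewrite lerBlDl (le_trans (lower_envelope_le_at x z k0))//.
by rewrite addrCA lerD2l -mulrDr ler_wpM2l// cdist_triangle.
Qed.

(** Points close to [x] have values close to [f x] by continuity, and the penalty eventually
    excludes the points that are far from [x]. *)
Lemma lower_envelope_cvg x : {for x, continuous f} ->
  lower_envelope f n%:R x @[n --> \oo] --> f x.
Proof.
move=> /(@cvgrPdist_lt _ _ _ (nbhs x) (nbhs_filter x)) cf.
apply/cvgrPdist_le => e e0.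
have /nbhs_cdist[d d0 xd] : nbhs x [set y | `|f x - f y| < e] by exact: cf.
near=> n.
rewrite ger0_norm ?subr_ge0 ?lower_envelope_le// lerBlDr -lerBlDl.
apply: lb_le_inf => [|_ [y _ <-]]; first by exists (f x + n%:R * cdist x x), x.
have [/xd/=|dxy] := ltP (cdist x y) d.
  rewrite ltr_norml => /andP[_ /ltW]; rewrite lerBlDr -lerBlDl => /le_trans; apply.
  by rewrite lerDl mulr_ge0// cdist_ge0.
(* With this, [f y + n * cdist x y] is at least [- B + 2 * B], hence at least [f x]. *)
have : 2 * B <= n%:R * cdist x y.
  apply: (@le_trans _ _ (n%:R * d)); last by rewrite ler_wpM2l.
  by rewrite -ler_pdivrMr//; near: n; exact: nbhs_infty_ger.
have := fB x; have := fB y; rewrite !ler_norml => /andP[? ?] /andP[? ?].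
lra.
Unshelve. all: by end_near. Qed.

End lipschitz_envelope.

(** * Continuous cutoffs with compact support in (0, +oo]^I *)

Section cutoff.
Context {R : realType} {m : nat} {I : {set 'I_m}}.
Local Notation E := (extvec R I).
Implicit Types (x y : E) (n : nat).

(* Equal to 1 where all contracted coordinates are at least 2/n, and to 0 as
   soon as one of them is at most 1/n. *)
Definition cutoff n x : R :=
  Num.max 0 (1 - \sum_i Num.max 0 (2 - n%:R * contract (x i))).

Lemma cutoff_ge0 n x : 0 <= cutoff n x.
Proof. by rewrite le_max lexx. Qed.

Lemma cutoff_le1 n x : cutoff n x <= 1.
Proof.
rewrite ge_max ler01/= lerBlDr lerDl sumr_ge0// => i _.
by rewrite le_max lexx.
Qed.

Lemma cutoff_eq1 n x : (forall i, 2 <= n%:R * contract (x i)) -> cutoff n x = 1.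
Proof.
move=> xn; rewrite /cutoff big1 ?subr0; first by apply: max_r.
by move=> i _; apply: max_l; rewrite subr_le0.
Qed.

Lemma cutoff_cvg x : posvec R I x -> cutoff n x @[n --> \oo] --> (1 : R).
Proof.
move=> x0; apply: cvg_near_cst.
have big i : \forall n \near \oo, 2 <= n%:R * contract (x i).
  have ci : 0 < contract (x i) by rewrite -(contract0 R) lt_contract; exact: x0.
  near=> n; rewrite -ler_pdivrMr//; near: n; exact: nbhs_infty_ger.
near=> n; apply: cutoff_eq1; near: n.
exact: (@filter_forall _ _ (fun i n => is_true (2 <= n%:R * contract (x i)))).
Unshelve. all: by end_near. Qed.

Lemma ler_max0B (a b : R) : Num.max 0 a - Num.max 0 b <= `|a - b|.
Proof.
rewrite lerBlDr ge_max; apply/andP; split.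
  by rewrite addr_ge0// le_max lexx.
rewrite -lerBlDr; apply: le_trans (ler_norm _).
by rewrite lerD2l lerN2 le_max lexx orbT.
Qed.

(** Both maxima with 0 are 1-Lipschitz, so [cutoff n] is [n]-Lipschitz for [cdist]. *)
Lemma cutoff_continuous n : continuous (cutoff n).
Proof.
apply: (@cdist_lipschitz_continuous _ _ _ _ n%:R) => x y.
apply: le_trans (ler_max0B _ _) _.
have subB (a b c : R) : c - a - (c - b) = b - a by ring.
rewrite subB -sumrB mulr_sumr.
apply: le_trans (ler_norm_sum _ _ _) _; apply: ler_sum => i _.
have key (a b : R) : `|Num.max 0 a - Num.max 0 b| <= `|a - b|.
  by rewrite ler_norml lerNl opprB ler_max0B distrC ler_max0B.
apply: le_trans (key _ _) _.
by rewrite subB -mulrBr normrM normr_nat distrC.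
Qed.

(** Meant for [cutoff n.+1]: the shift keeps the threshold positive at [n = 0]. Infinite coordinates
    belong to the set, which makes it compact. *)
Definition cutoff_support n : set E :=
  [set x | forall i, n.+1%:R^-1 <= contract (x i)].

Lemma cutoff_out n x : ~ cutoff_support n x -> cutoff n.+1 x = 0.
Proof.
move=> /existsNP[i /negP]; rewrite -ltNge => xi.
apply: max_l; rewrite subr_le0.
(* One coordinate below the threshold already contributes at least 1 to the subtracted sum. *)
have : 1 <= 2 - n.+1%:R * contract (x i).
  rewrite lerBrDr -lerBrDl (_ : 2 - 1 = 1); last by ring.
  by rewrite -ler_pdivlMl// mulr1 ltW.
move=> /le_trans; apply.
rewrite (bigD1 i)//= -[leLHS]addr0 lerD// ?sumr_ge0// => [|j _];
  by rewrite le_max lexx ?orbT.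
Qed.

Lemma cutoff_support_posvec n : cutoff_support n `<=` posvec R I.
Proof.
move=> x xn i; rewrite -lt_contract contract0.
by apply: lt_le_trans (xn i); rewrite invr_gt0.
Qed.

(** The set is the image of the segment from [a] to 1 under [expand], which is an isometry there for
    the metric given by [contract]. The bound on [a] keeps the segment in the range of
    [contract]. *)
Lemma compact_ge_contract (a : R) : -1 <= a ->
  compact [set y : \bar R | a <= contract y].
Proof.
move=> a1.
suff -> : [set y : \bar R | a <= contract y] = @expand R @` `[a, 1].
  apply: continuous_compact; last exact: segment_compact.
  have cexp (s : R) : `[a, 1]%classic s -> contract (expand s) = s.
    rewrite /= in_itv/= => /andP[as_ s1].
    by rewrite expandK// inE ler_norml s1 andbT (le_trans a1).
  apply/subspace_continuousP => r rI.
  move=> A /nbhs_ballP[e /= e0 eA].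
  suff : \forall s \near nbhs r, `[a, 1]%classic s -> A (expand s) by [].
  apply/nbhs_ballP; exists e => // s rs sI; apply: eA.
  by rewrite /ball /= /ereal_ball !cexp.
rewrite eqEsubset; split => [y /= ay|y [r]].
  exists (contract y); last exact: contractK.
  rewrite /= in_itv/= ay/=.
  by have := contract_le1 y; rewrite ler_norml => /andP[].
rewrite /= in_itv/= => /andP[ar r1] <-; rewrite expandK// inE ler_norml r1 andbT.
exact: le_trans ar.
Qed.

Lemma cutoff_support_compact n : compact (cutoff_support n).
Proof.
apply: (@tychonoff _ (fun _ : {i | i \in I} => \bar R)
  (fun _ => [set y | n.+1%:R^-1 <= contract y])) => _.
apply: compact_ge_contract; rewrite (@le_trans _ _ 0)// ?invr_ge0//.
Qed.

End cutoff.

(** * Measurability and dominated convergence *)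

Section measure_lemmas.
Context {R : realType} d {T : measurableType d}.

Lemma bounded_integrable (mu : {finite_measure set T -> \bar R}) (f : T -> R)
    (B : R) : measurable_fun setT f -> (forall x, `|f x| <= B) ->
  mu.-integrable setT (EFin \o f).
Proof.
move=> mf fB; apply: measurable_bounded_integrable => //.
  by rewrite -ge0_fin_numE//; exact: fin_num_measure.
exists B; split; first exact: num_real.
by move=> M BM x _; apply: le_trans (fB x) (ltW BM).
Qed.

Lemma Rintegral_dominated_cvg (mu : {measure set T -> \bar R}) (D : set T)
    (f_ : nat -> T -> R) (f g : T -> R) : measurable D ->
  (forall n, measurable_fun D (f_ n)) -> measurable_fun D f ->
  {ae mu, forall x, D x -> f_ n x @[n --> \oo] --> f x} ->
  mu.-integrable D (EFin \o g) ->
  (forall n x, D x -> `|f_ n x| <= g x) ->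
  \int[mu]_(x in D) f_ n x @[n --> \oo] --> \int[mu]_(x in D) f x.
Proof.
move=> mD mf_ mf f_f ig f_g.
have [||||| fi _ fc] := @dominated_convergence _ _ _ mu D mD
    (fun n => EFin \o f_ n) (EFin \o f) (EFin \o g).
- by move=> n; exact/measurable_EFinP.
- exact/measurable_EFinP.
- apply: filterS f_f => x + Dx => /(_ Dx) fx.
  by apply: cvg_EFin; [exact: nearW|exact: fx].
- exact: ig.
- by apply: aeW => x n Dx; rewrite /= lee_fin f_g.
have fin : (\int[mu]_(x in D) (f x)%:E \is a fin_num)%E.
  exact: integrable_fin_num fi.
by move: fc; rewrite -[X in _ --> X](fineK fin); exact: fine_cvg.
Qed.

End measure_lemmas.

Section borel_extvec.
Context {R : realType} {m : nat} {I : {set 'I_m}}.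
Local Notation E := (extvec R I).

(** The sigma-algebra is generated by the open sets of the product, not by the projections. Second
    countability bridges the gap: an open set is a countable union of boxes with rational ends in
    the contracted coordinates. *)
Lemma measurable_fun_extvec d (T : measurableType d) (g : T -> E) :
  (forall i, measurable_fun setT (fun om => contract (g om i))) ->
  measurable_fun setT (g : T -> borel_extvec R I).
Proof.
move=> mg; apply: (@measurability _ _ T (borel_extvec R I) setT g (@open E)) => //.
move=> _ [U oU <-].
rewrite setTI.
pose J := {i | i \in I}.
pose box (b : {ffun J -> rat * rat}) : set E :=
  [set y | forall i, ratr (b i).1 < contract (y i) < ratr (b i).2].
(* Boxes not contained in [U] contribute nothing, so the union can run over the whole countable type
   of pairs of rational ends. *)
pose F b : set T := if `[< box b `<=` U >] then g @^-1` box b else set0.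
have -> : g @^-1` U = \bigcup_b F b.
  rewrite eqEsubset; split => [om /= Ug|om [b _]]; last first.
    by rewrite /F; case: asboolP => // bU; exact: bU.
  have /nbhs_cdist[e e0 eU] : nbhs (g om) U by exact: open_nbhs_nbhs.
  have e'0 : 0 < e / (#|I|.+1)%:R by rewrite divr_gt0.
  (* The rational ends lie so close to the coordinates of [g om] that the box fits in the [cdist]
     ball of radius [e]. *)
  have /fin_all_exists[b bP] (i : J) : exists pq : rat * rat,
      [/\ contract (g om i) - e / (#|I|.+1)%:R < ratr pq.1,
          ratr pq.1 < contract (g om i), contract (g om i) < ratr pq.2
        & ratr pq.2 < contract (g om i) + e / (#|I|.+1)%:R].
    have [|p] := @rat_in_itvoo R (contract (g om i) - e / (#|I|.+1)%:R)
      (contract (g om i)); first by rewrite ltrBlDr ltrDl.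
    have [|q] := @rat_in_itvoo R (contract (g om i))
      (contract (g om i) + e / (#|I|.+1)%:R); first by rewrite ltrDl.
    by rewrite !in_itv/= => /andP[? ?] /andP[? ?]; exists (p, q).
  exists (finfun b) => //; rewrite /F; case: asboolP => [_ i|[]].
    by rewrite ffunE; have [_ -> ->] := bP i.
  move=> y yb; apply: eU; apply: cdist_lt => // i.
  have := yb i; rewrite ffunE => /andP[py yq]; have [cp _ _ qc] := bP i.
  rewrite ltr_norml; move: cp qc; move: (e / (#|I|.+1)%:R) => e' cp qc.
  by apply/andP; split; lra.
apply: countable_bigcupT_measurable => [|b]; first exact: countableP.
rewrite /F; case: ifPn => // _.
have -> : g @^-1` box b = \bigcap_(i in [set: J])
    (fun om => contract (g om i)) @^-1` `](ratr (b i).1), (ratr (b i).2)[.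
  rewrite eqEsubset; split => om /= gb i => [_|]; first by rewrite /= in_itv/=.
  by have := gb i Logic.I; rewrite /= in_itv.
apply: fin_bigcap_measurable => [|i _]; first exact: finite_finset.
by rewrite -[X in measurable X]setTI; exact: mg.
Qed.

Lemma measurable_posvec : measurable (posvec R I : set (borel_extvec R I)).
Proof.
have -> : posvec R I = \bigcap_(i in [set: {i | i \in I}])
    (fun x : E => contract (x i)) @^-1` `]0, +oo[.
  rewrite eqEsubset; split => x /= xP i.
    by move=> _; rewrite /= in_itv/= andbT -(contract0 R) lt_contract.
  by have := xP i Logic.I; rewrite /= in_itv/= andbT -(contract0 R) lt_contract.
apply: fin_bigcap_measurable => [|i _]; first exact: finite_finset.
rewrite -[X in measurable X]setTI.
by apply: continuous_measurable_extvec => //; exact: contract_proj_continuous.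
Qed.

Lemma measurable_cutoff_support n :
  measurable (cutoff_support n : set (borel_extvec R I)).
Proof.
have -> : cutoff_support n = \bigcap_(i in [set: {i | i \in I}])
    (fun x : E => contract (x i)) @^-1` `[n.+1%:R^-1, +oo[.
  rewrite eqEsubset; split => x /= xP i.
    by move=> _; rewrite /= in_itv/= andbT; exact: xP.
  by have := xP i Logic.I; rewrite /= in_itv/= andbT.
apply: fin_bigcap_measurable => [|i _]; first exact: finite_finset.
rewrite -[X in measurable X]setTI.
by apply: continuous_measurable_extvec => //; exact: contract_proj_continuous.
Qed.

(** The cutoff is dominated by the indicator of a compact subset of (0, +oo]^I, which has finite
    measure. *)
Lemma integrable_cutoff (nu : {measure set (borel_extvec R I) -> \bar R}) n :
  radon_posvec nu -> nu.-integrable (posvec R I) (EFin \o cutoff n.+1).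
Proof.
move=> radon; have mp := measurable_posvec; have mc := measurable_cutoff_support n.
have mcut := continuous_measurable_extvec (@cutoff_continuous R m I n.+1).
apply: (@le_integrable _ _ _ _ _ mp _ (EFin \o \1_(cutoff_support n))).
- exact/measurable_EFinP/measurable_funTS.
- move=> x _ /=; rewrite lee_fin ger0_norm ?cutoff_ge0//.
  rewrite ger0_norm// indicE; have [xn|/negP xn] := boolP (x \in _).
    exact: cutoff_le1.
  by rewrite cutoff_out// => /mem_set.
apply/integrableP; split; first exact/measurable_EFinP/measurable_indic.
under eq_integral do rewrite gee0_abs ?lee_fin//.
rewrite integral_indic// setIidl; last exact: cutoff_support_posvec.
by apply: radon; [exact: cutoff_support_compact|exact: cutoff_support_posvec].
Qed.

End borel_extvec.

(** * Measurability and boundedness of the face increments *)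

Section scaled_face.
Context {R : realType} {m : nat} {d : measure_display} {T : measurableType d}.
Context {P : probability T R} (w : 'I_m -> R) (X : 'I_m -> {RV P >-> R}).
Implicit Types (I : {set 'I_m}) (t : R).

Lemma measurable_scaled_face I t :
  measurable_fun setT (scaled_face X I t : T -> borel_extvec R I).
Proof.
apply: measurable_fun_extvec => i.
have mc : measurable_fun setT (fun y : R => contract y%:E).
  apply: continuous_measurable_fun => y.
  apply: (@continuous_comp _ _ _ EFin (@contract R)); last exact: contract_continuous.
  by apply: cvg_EFin; [exact: nearW|exact: cvg_id].
apply: (measurableT_comp mc); apply: measurable_funM => //.
Qed.

Lemma Gface_norm_le I : exists2 B : R, 0 <= B & forall x, `|Gface w I x| <= B.
Proof.
(* The bound is the number of subsets of [I], since each term of the alternating sum is at most 1 in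
   absolute value. *)
exists (\sum_(J : {set 'I_m} | J \subset I) 1); first exact: sumr_ge0.
move=> x; apply: le_trans (ler_norm_sum _ _ _) _; apply: ler_sum => J _.
rewrite normrM normrX normrN1 expr1n mul1r /gface.
by case: (1 < _)%E; rewrite ?normr1 ?normr0.
Qed.

Lemma gface_extend0_face (J I : {set 'I_m}) (x : 'I_m -> R) : J \subset I ->
  gface w J (extend0 (face I x)) = (1 < \sum_(i in J) w i * x i)%R%:R.
Proof.
move=> JI; rewrite /gface -lte_fin -sumEFin.
congr ((_ < _)%E)%:R; apply: eq_bigr => i iJ; rewrite /extend0.
by case: insubP => [j _ <-//|]; rewrite (fintype.subsetP JI).
Qed.

(** The argument goes through the real formula for [gface] at finite points, which bypasses Borel
    measurability of [Gface] on the extended cube. *)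
Lemma measurable_Gface_scaled I t :
  measurable_fun setT (fun om => Gface w I (scaled_face X I t om)).
Proof.
rewrite /Gface; under eq_fun do rewrite big_mkcond.
apply: measurable_sum => J; have [JI|_] := boolP (J \subset I); last first.
  exact: measurable_cst.
apply: measurable_funM => //.
under eq_fun do rewrite (gface_extend0_face _ JI) mulrb.
apply: measurable_fun_ifT => //.
apply: measurable_fun_ltr => //.
under eq_fun do rewrite big_mkcond.
apply: measurable_sum => i; case: (i \in J) => //.
apply: measurable_funM => //; exact: measurable_funM.
Qed.

End scaled_face.

(** * Vague convergence against almost everywhere continuous functions *)

Lemma fine_expectation (R : realType) d (T : measurableType d)
  (P : probability T R) (Y : T -> R) : fine 'E_P[Y] = \int[P]_om Y om.
Proof. by rewrite unlock. Qed.

Section transfer.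
Context {R : realType} {m : nat} {d : measure_display} {T : measurableType d}.
Context {P : probability T R} (w : 'I_m -> R) (X : 'I_m -> {RV P >-> R}).
Context (I : {set 'I_m}) (r : R -> R).
Local Notation E := (extvec R I).
Local Notation sf t om := (scaled_face X I t om).
Implicit Types (f : E -> R) (t : R).

Let measurable_scaled f t : measurable_fun [set: borel_extvec R I] f ->
  measurable_fun setT (fun om => f (sf t om)).
Proof.
move=> mf; have ms := @measurable_scaled_face _ _ _ _ P X I t.
exact: (@measurableT_comp _ _ _ T (borel_extvec R I) R f _ _ mf ms).
Qed.

Let normM_cutoff_le f (B : R) n x : `|f x| <= B -> `|f x * cutoff n x| <= B.
Proof.
move=> fB; rewrite normrM (ger0_norm (cutoff_ge0 _ _)).
by apply: le_trans fB; rewrite ler_piMr// cutoff_le1.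
Qed.

Let integrable_scaled_cutoff f (B : R) n t :
  (forall x, `|f x| <= B) ->
  measurable_fun setT (fun om => f (sf t om)) ->
  P.-integrable setT (EFin \o (fun om =>
    f (sf t om) * cutoff n (sf t om))).
Proof.
move=> fB mf; apply: (@bounded_integrable _ _ _ _ _ B).
  apply: measurable_funM => //; apply: measurable_scaled.
  by apply: continuous_measurable_extvec; exact: cutoff_continuous.
by move=> om; exact: normM_cutoff_le.
Qed.

Context (nu : {measure set (borel_extvec R I) -> \bar R}).
Hypothesis radon : radon_posvec nu.
Hypothesis vague : vague_transfer X r nu.

Lemma vague_cutoff f n : continuous f ->
  (r t)^-1 * \int[P]_om (f (sf t om) * cutoff n.+1 (sf t om))
    @[t --> +oo] --> \int[nu]_(x in posvec R I) (f x * cutoff n.+1 x).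
Proof.
move=> cf.
pose g x := f x * cutoff n.+1 x.
have EE : (fun t => (r t)^-1 * \int[P]_om g (sf t om)) =
    (fun t => (r t)^-1 * fine 'E_P[fun om => g (sf t om)]).
  by apply/funext => t; rewrite fine_expectation.
rewrite [X in X @ _ --> _]EE; apply: vague.
  by move=> x; apply: continuousM; [exact: cf|exact: cutoff_continuous].
exists (cutoff_support n); split.
- exact: cutoff_support_compact.
- exact: cutoff_support_posvec.
- by move=> x /cutoff_out cx; rewrite /g cx mulr0.
Qed.

Hypothesis r_gt0 : \forall t \near +oo, 0 < r t.

Let negligible_discont f :=
  nu.-negligible [set x | posvec R I x /\ ~ {for (x : E), continuous f}].

(** Dominated convergence in [k]: the envelopes converge at the continuity points of [f], hence
    almost everywhere, and [B * cutoff n.+1] is an integrable bound. *)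
Lemma lower_envelope_cutoff_cvg f (B : R) n : (forall x, `|f x| <= B) ->
  measurable_fun (posvec R I : set (borel_extvec R I)) f ->
  negligible_discont f ->
  \int[nu]_(x in posvec R I) (lower_envelope f k%:R x * cutoff n.+1 x)
    @[k --> \oo] --> \int[nu]_(x in posvec R I) (f x * cutoff n.+1 x).
Proof.
move=> fB mf [N [mN N0 subN]].
have mcut := continuous_measurable_extvec (@cutoff_continuous R m I n.+1).
apply: (@Rintegral_dominated_cvg _ _ _ nu _ _ _
  (fun x => B * cutoff n.+1 x) measurable_posvec).
- move=> k; apply: measurable_funM; apply: measurable_funTS => //.
  by apply: continuous_measurable_extvec; exact: lower_envelope_continuous fB _ _.
- by apply: measurable_funM => //; exact: measurable_funTS.
- exists N; split => //; apply: subset_trans subN => x /= /not_implyP[x0 nc].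
  split => // cf; apply: nc; apply: cvgM; last exact: cvg_cst.
  exact: lower_envelope_cvg fB _ _.
- have := @integrableZl _ _ _ nu _ measurable_posvec B _ (integrable_cutoff n radon).
  by apply: eq_integrable => //; exact: measurable_posvec.
- move=> k x x0; rewrite normrM (ger0_norm (cutoff_ge0 _ _)) ler_wpM2r ?cutoff_ge0//.
  exact: lower_envelope_norm_le.
Qed.

Let integrable_cutoffM f (B : R) n : (forall x, `|f x| <= B) ->
  measurable_fun (posvec R I : set (borel_extvec R I)) f ->
  nu.-integrable (posvec R I) (EFin \o (fun x => f x * cutoff n.+1 x)).
Proof.
move=> fB mf; have mp := @measurable_posvec R m I.
apply: (@le_integrable _ _ _ _ _ mp _ (fun x => B%:E * (EFin \o cutoff n.+1) x)%E).
- apply/measurable_EFinP; apply: measurable_funM => //.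
  apply: measurable_funTS; apply: continuous_measurable_extvec.
  exact: cutoff_continuous.
- move=> x _; rewrite /= lee_fin !normrM ler_wpM2r//.
  exact: le_trans (fB x) (ler_norm _).
- exact: (@integrableZl _ _ _ nu _ mp B _ (integrable_cutoff n radon)).
Qed.

Lemma vague_ae_continuous f (B : R) n : (forall x, `|f x| <= B) ->
  measurable_fun (posvec R I : set (borel_extvec R I)) f ->
  (forall t, measurable_fun setT (fun om => f (sf t om))) ->
  negligible_discont f ->
  (r t)^-1 * \int[P]_om (f (sf t om) * cutoff n.+1 (sf t om))
    @[t --> +oo] --> \int[nu]_(x in posvec R I) (f x * cutoff n.+1 x).
Proof.
move=> fB mf mfX nf.
(* The lower half of the convergence, for a general [g] so that it applies to [f] and to [- f]. One
   half of [e] is spent on the choice of the envelope index [k], the other on the vague convergence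
   for that envelope. *)
have lower (g : E -> R) : (forall x, `|g x| <= B) ->
    measurable_fun (posvec R I : set (borel_extvec R I)) g ->
    (forall t, measurable_fun setT (fun om => g (sf t om))) ->
    negligible_discont g -> forall e, 0 < e -> \forall t \near +oo,
    \int[nu]_(x in posvec R I) (g x * cutoff n.+1 x) - e <
    (r t)^-1 * \int[P]_om (g (sf t om) * cutoff n.+1 (sf t om)).
  move=> gB mg mgX ng e e0; have e2 : 0 < e / 2 by rewrite divr_gt0.
  have /cvgrPdist_lt/(_ _ e2) :=
    @lower_envelope_cutoff_cvg g B n gB mg ng.
  case=> k _ /(_ k (leqnn _)) /= kg.
  have cl := lower_envelope_continuous gB (ler0n R k).
  have /cvgrPdist_lt/(_ _ e2) := @vague_cutoff _ n cl.
  move=> lt; near=> t.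
  have rt : 0 < r t by near: t.
  have lekg : (r t)^-1 * \int[P]_om (lower_envelope g k%:R (sf t om)
        * cutoff n.+1 (sf t om)) <=
      (r t)^-1 * \int[P]_om (g (sf t om)
        * cutoff n.+1 (sf t om)).
    rewrite ler_wpM2l ?invr_ge0 ?(ltW rt)//; apply: le_Rintegral => //.
    - apply: (@integrable_scaled_cutoff _ B).
        by move=> x; exact: lower_envelope_norm_le.
      by apply: measurable_scaled; exact: continuous_measurable_extvec.
    - exact: (@integrable_scaled_cutoff _ B).
    - move=> om _; rewrite ler_wpM2r ?cutoff_ge0//.
      by apply: (lower_envelope_le gB).
  apply: lt_le_trans lekg; move: kg.
  have : `|\int[nu]_(x in posvec R I) (lower_envelope g k%:R x * cutoff n.+1 x) -
     (r t)^-1 * \int[P]_om (lower_envelope g k%:R (sf t om)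
        * cutoff n.+1 (sf t om))| < e / 2 by near: t; exact: lt.
  rewrite !ltr_norml => /andP[_ h1] /andP[_ h2].
  move: h1 h2; move: (Rintegral nu _ _) (Rintegral nu _ _) (_ * Rintegral P _ _).
  by move=> a b c h1 h2; lra.
apply/cvgrPdist_lt => e e0; near=> t.
have lo : \int[nu]_(x in posvec R I) (f x * cutoff n.+1 x) - e <
    (r t)^-1 * \int[P]_om (f (sf t om) * cutoff n.+1 (sf t om)).
  by near: t; exact: lower.
have up : \int[nu]_(x in posvec R I) (- f x * cutoff n.+1 x) - e <
    (r t)^-1 * \int[P]_om (- f (sf t om) * cutoff n.+1 (sf t om)).
  near: t; apply: (lower (fun x => - f x)) => //.
  - by move=> x; rewrite normrN.
  - exact: measurable_funN.
  - by move=> s; exact: measurable_funN.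
  - case: nf => N [mN N0 subN]; exists N; split => //.
    apply: subset_trans subN => x [x0 nc]; split => // cf; apply: nc.
    exact: (@continuousN R R^o E f x cf).
move: up; have -> : \int[nu]_(x in posvec R I) (- f x * cutoff n.+1 x) =
    - \int[nu]_(x in posvec R I) (f x * cutoff n.+1 x).
  rewrite -mulN1r -RintegralZl; [|exact: measurable_posvec|exact: integrable_cutoffM fB mf].
  by apply: eq_Rintegral => x _; rewrite mulN1r mulNr.
have -> : \int[P]_om (- f (sf t om) * cutoff n.+1 (sf t om)) =
    - \int[P]_om (f (sf t om) * cutoff n.+1 (sf t om)).
  rewrite -mulN1r -RintegralZl//; last exact: (@integrable_scaled_cutoff _ B).
  by apply: eq_Rintegral => x _; rewrite mulN1r mulNr.
move: lo; rewrite mulrN; move: (Rintegral nu _ _) (_ * Rintegral P _ _) => a b.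
rewrite ltrBlDr -opprD ltrN2 => lo up.
by rewrite ltr_norml ltrBrDr addrC ltrBlDr up ltrBlDr addrC.
Unshelve. all: by end_near. Qed.

End transfer.

(** * Uniform integrability and the transfer on one face *)

Section uniform_integrability.
Context {R : realType} {m : nat} {d : measure_display} {T : measurableType d}.
Context {P : probability T R} (w : 'I_m -> R) (X : 'I_m -> {RV P >-> R}).
Context (I : {set 'I_m}) (r : R -> R).
Local Notation sf t om := (scaled_face X I t om).
Hypothesis r_gt0 : \forall t \near +oo, 0 < r t.

Lemma measurable_box (eps M : R) :
  measurable (box I eps M : set (borel_extvec R I)).
Proof.
have -> : box I eps M = \bigcap_(i in [set: {i | i \in I}])
    (fun x : extvec R I => contract (x i)) @^-1`
      `[contract eps%:E, contract M%:E].
  rewrite eqEsubset; split => x /= xP i.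
    move=> _; suff : contract eps%:E <= contract (x i) <= contract M%:E.
      by rewrite /= in_itv.
    by rewrite !le_contract; exact: xP.
  have : contract eps%:E <= contract (x i) <= contract M%:E.
    by have := xP i Logic.I; rewrite /= in_itv.
  by rewrite !le_contract.
apply: fin_bigcap_measurable => [|i _]; first exact: finite_finset.
rewrite -[X in measurable X]setTI.
by apply: continuous_measurable_extvec => //; exact: contract_proj_continuous.
Qed.

Lemma integrable_Gface_scaled t :
  P.-integrable setT (EFin \o (fun om => Gface w I (sf t om))).
Proof.
have [B _ GB] := Gface_norm_le w I.
by apply: bounded_integrable => //; exact: measurable_Gface_scaled.
Qed.

(** The weight [h] will be a cutoff, 1 minus a cutoff, the indicator of the complement of a box, or
    the constant 1. *)
Lemma integrable_absGface_scaled (h : extvec R I -> R) t :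
  measurable_fun [set: borel_extvec R I] h -> (forall x, 0 <= h x <= 1) ->
  P.-integrable setT (EFin \o (fun om => `|Gface w I (sf t om)| *
    h (sf t om))).
Proof.
move=> mh h01; have [B B0 GB] := Gface_norm_le w I.
apply: (@bounded_integrable _ _ _ _ _ B).
  apply: measurable_funM.
    by apply: measurableT_comp => //; exact: measurable_Gface_scaled.
  exact: (@measurableT_comp _ _ _ T (borel_extvec R I) R h _ _ mh
    (@measurable_scaled_face _ _ _ _ P X I t)).
move=> om; rewrite normrM normr_id; case/andP: (h01 (sf t om)) => h0 h1.
by rewrite (ger0_norm h0); apply: le_trans (GB (sf t om)); rewrite ler_piMr.
Qed.

(** For large [n] the cutoff equals 1 on the chosen box, so [1 - cutoff n.+1] is at most the
    indicator of the complement of that box. *)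
Lemma uniformly_integrable_cutoff : uniformly_integrable w X I r ->
  forall e, 0 < e -> \forall n \near \oo, \forall t \near +oo,
  (r t)^-1 * \int[P]_om (`|Gface w I (sf t om)| *
    (1 - cutoff n.+1 (sf t om))) < e.
Proof.
move=> UI e e0.
have /UI : nbhs (0 : \bar R)%E [set y | (y < e%:E)%E].
  by exists e => //= y; rewrite /ball_/= sub0r normrN lte_fin => /ltr_normlW.
case=> -[A B] /= [A0 Boo] AB.
have [eps Aeps eps0] : exists2 eps : R, A eps & 0 < eps.
  case: A0 => a /= a0 aA; exists (a / 2); last by rewrite divr_gt0.
  apply: aA => /=; last by rewrite divr_gt0.
  by rewrite sub0r normrN gtr0_norm ?divr_gt0// ltr_pdivrMr// mulr_natr mulr2n ltrDl.
have [M BM] : exists M, B M.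
  by case: Boo => a [_ aB]; exists (a + 1); apply: aB; rewrite ltrDl.
(* An upper limit is an infimum of suprema over neighbourhoods; as it lies below [e], so does the
   supremum over some neighbourhood [V] of infinity. *)
have /ereal_inf_lt[_ /= [V Voo <-] supV] := AB (eps, M) (conj Aeps BM).
have ceps : 0 < contract eps%:E by rewrite -(contract0 R) lt_contract lte_fin.
near=> n; near=> t.
have rt : 0 < r t by near: t.
apply: (@le_lt_trans _ _ ((r t)^-1 * \int[P]_om
    (`|Gface w I (sf t om)| *
     \1_(~` box I eps M) (sf t om)))).
  rewrite ler_wpM2l ?invr_ge0 ?(ltW rt)//; apply: le_Rintegral => //.
  - apply: (@integrable_absGface_scaled (fun x => 1 - cutoff n.+1 x)).
      apply: measurable_funB => //; apply: continuous_measurable_extvec.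
      exact: cutoff_continuous.
    by move=> x; rewrite subr_ge0 cutoff_le1 lerBlDr lerDl cutoff_ge0.
  - apply: (@integrable_absGface_scaled (\1_(~` box I eps M))).
      by apply: measurable_indic; apply: measurableC; exact: measurable_box.
    by move=> x; rewrite indicE lern1 leq_b1 ler0n.
  - move=> om _; rewrite ler_wpM2l// indicE.
    have [xb|xb] := boolP (_ \in _); first by rewrite lerBlDr lerDl cutoff_ge0.
    rewrite cutoff_eq1 ?subrr// => i.
    have xbox : box I eps M (sf t om).
      by apply: contrapT => nb; move/negP: xb; apply; rewrite inE.
    have /andP[+ _] := xbox i; rewrite -le_contract => lec.
    apply: (@le_trans _ _ (n.+1%:R * contract eps%:E)); last by rewrite ler_wpM2l.
    rewrite -ler_pdivrMr//; apply: (@le_trans _ _ n%:R).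
      by near: n; exact: nbhs_infty_ger.
    by rewrite ler_nat.
rewrite -lte_fin; apply: le_lt_trans supV; apply: ereal_sup_ubound.
exists t; first by near: t.
have intG : P.-integrable setT (EFin \o (fun om =>
    `|Gface w I (sf t om)| *
    \1_(~` box I eps M) (sf t om))).
  apply: (@integrable_absGface_scaled (\1_(~` box I eps M))).
    by apply: measurable_indic; apply: measurableC; exact: measurable_box.
  by move=> x; rewrite indicE lern1 leq_b1 ler0n.
rewrite EFinM -fine_expectation fineK//.
by rewrite expectation.unlock; exact: integrable_fin_num intG.
Unshelve. all: by end_near. Qed.

End uniform_integrability.

Section face_transfer.
Context {R : realType} {m : nat} {d : measure_display} {T : measurableType d}.
Context {P : probability T R} (w : 'I_m -> R) (X : 'I_m -> {RV P >-> R}).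
Context (I : {set 'I_m}) (r : R -> R).
Context (nu : {measure set (borel_extvec R I) -> \bar R}).
Hypothesis hyps : transfer_hyps w X r nu.

Local Notation sf t om := (scaled_face X I t om).

Let cutoff01 n (x : extvec R I) : 0 <= cutoff n x <= 1.
Proof. by rewrite cutoff_ge0 cutoff_le1. Qed.

Let cutoffB01 n (x : extvec R I) : 0 <= 1 - cutoff n x <= 1.
Proof. by rewrite subr_ge0 cutoff_le1 lerBlDr lerDl cutoff_ge0. Qed.

Let mcutoff n := continuous_measurable_extvec (@cutoff_continuous R m I n).

Let mcutoffB n :
  measurable_fun [set: borel_extvec R I] (fun x => 1 - cutoff n x).
Proof. exact: measurable_funB. Qed.

Let mcutoffX n t : measurable_fun setT (fun om => cutoff n (sf t om)).
Proof.
exact: (@measurableT_comp _ _ _ T (borel_extvec R I) R _ _ _ (mcutoff n)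
  (@measurable_scaled_face _ _ _ _ P X I t)).
Qed.

(** Measurability on (0, +oo]^I is part of the integrability hypothesis. *)
Let measurable_Gface_pos :
  measurable_fun (posvec R I : set (borel_extvec R I)) (Gface w I).
Proof. by case: hyps => _ _ _ /integrableP[/measurable_EFinP]. Qed.

(** The cutoffs tend to 1 on (0, +oo]^I and the integrable function [|Gface w I|] dominates. *)
Lemma Gface_cutoff_cvg :
  \int[nu]_(x in posvec R I) (Gface w I x * cutoff n.+1 x)
    @[n --> \oo] --> \int[nu]_(x in posvec R I) Gface w I x.
Proof.
apply: (@Rintegral_dominated_cvg _ _ _ nu _ _ _ (fun x => `|Gface w I x|)
  measurable_posvec).
- by move=> n; apply: measurable_funM => //; exact: measurable_funTS.
- exact: measurable_Gface_pos.
- apply: aeW => x x0; rewrite -[X in _ --> X]mulr1.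
  apply: cvgM; first exact: cvg_cst.
  by rewrite (cvg_shiftS (fun n => cutoff n x)); exact: cutoff_cvg.
- by case: hyps => _ _ _ + _; exact: integrable_norm.
- by move=> n x _; rewrite normrM ler_piMr// ger0_norm ?cutoff_ge0 ?cutoff_le1.
Qed.

Lemma transfer_cvg : (r t)^-1 * mean_G w X I t @[t --> +oo] -->
  \int[nu]_(x in posvec R I) Gface w I x.
Proof.
have [[r0 _ _] [radon vague] disc Gint UI] := hyps.
have [B B0 GB] := Gface_norm_le w I.
apply/cvgrPdist_lt => e e0; have e3 : 0 < e / 3 by rewrite divr_gt0.
(* The index [n] is fixed before [t]: it makes the two cutoff errors, under [nu] and under the
   scaled law, smaller than [e / 3]. Vague convergence at this [n] gives the third error. *)
near \oo => n.
have nUI : \forall t \near +oo, (r t)^-1 * \int[P]_om (`|Gface w I (sf t om)| *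
    (1 - cutoff n.+1 (sf t om))) < e / 3.
  by near: n; exact: uniformly_integrable_cutoff.
have nG : `|\int[nu]_(x in posvec R I) Gface w I x -
    \int[nu]_(x in posvec R I) (Gface w I x * cutoff n.+1 x)| < e / 3.
  by near: n; move: (e / 3) e3; apply/cvgrPdist_lt; exact: Gface_cutoff_cvg.
have /cvgrPdist_lt/(_ _ e3) tG := @vague_ae_continuous _ _ _ _ _ X I r nu radon
  vague r0 (Gface w I) B n GB measurable_Gface_pos
  (@measurable_Gface_scaled _ _ _ _ P w X I) disc.
near=> t.
have rt : 0 < r t by near: t.
have iG := @integrable_Gface_scaled _ _ _ _ P w X I t.
have iGc : P.-integrable setT
    (EFin \o (fun om => Gface w I (sf t om) * cutoff n.+1 (sf t om))).
  apply: (@bounded_integrable _ _ _ _ _ B).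
    by apply: measurable_funM; [exact: measurable_Gface_scaled|exact: mcutoffX].
  move=> om; rewrite normrM [X in _ * X]ger0_norm ?cutoff_ge0//.
  by apply: le_trans (GB (sf t om)); rewrite ler_piMr// cutoff_le1.
have le3 : `|(r t)^-1 * \int[P]_om (Gface w I (sf t om) * cutoff n.+1 (sf t om)) -
     (r t)^-1 * mean_G w X I t| < e / 3.
  apply: le_lt_trans (_ : (r t)^-1 * \int[P]_om (`|Gface w I (sf t om)| *
    (1 - cutoff n.+1 (sf t om))) < e / 3); last by near: t.
  rewrite /mean_G fine_expectation -mulrBr normrM gtr0_norm ?invr_gt0//.
  rewrite ler_wpM2l ?invr_ge0 ?(ltW rt)// -RintegralB//.
  apply: le_trans (le_normr_Rintegral _ _) _ => //.
    by have := integrableB measurableT iGc iG.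
  rewrite le_eqVlt; apply/orP; left; apply/eqP; apply: eq_Rintegral => om _.
  rewrite -[X in _ - X]mulr1 -mulrBr normrM distrC.
  by rewrite [X in _ * X]ger0_norm// subr_ge0 cutoff_le1.
have le2 : `|\int[nu]_(x in posvec R I) (Gface w I x * cutoff n.+1 x) -
    (r t)^-1 * \int[P]_om (Gface w I (sf t om) * cutoff n.+1 (sf t om))| < e / 3.
  by near: t.
rewrite (_ : e = e / 3 + (e / 3 + e / 3)); last by field.
apply: le_lt_trans (ler_distD _ _ _) _; apply: ltrD; first exact: nG.
by apply: le_lt_trans (ler_distD _ _ _) _; apply: ltrD; [exact: le2|exact: le3].
Unshelve. all: by end_near. Qed.

Lemma transfer_eqo : mean_G w X I =
  (fun t => r t * \int[nu]_(x in posvec R I) Gface w I x) +o_ (+oo_ R) r.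
Proof.
have [[r0 _ _] _ _ _ _] := hyps.
apply/eqaddoP => e e0; near=> t.
have rt : 0 < r t by near: t.
rewrite [X in _ * X]gtr0_norm// mulrC -ler_pdivrMl//.
rewrite -[X in X * _]gtr0_norm ?invr_gt0// -normrM mulrBr.
rewrite [X in _ - X]mulKf ?gt_eqF// distrC.
near: t; move: e e0; apply/cvgrPdist_le; exact: transfer_cvg.
Unshelve. all: by end_near. Qed.

(** An upper bound suffices here, so under the cutoff [|Gface|] is replaced by the constant [B], a
    continuous function to which vague convergence applies; uniform integrability bounds the
    rest. *)
Lemma transfer_absG_bigO :
  exists2 C : R, 0 < C & \forall t \near +oo, mean_absG w X I t <= C * r t.
Proof.
have [[r0 _ _] [radon vague] disc Gint UI] := hyps.
have [B B0 GB] := Gface_norm_le w I.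
near \oo => n.
have nUI : \forall t \near +oo, (r t)^-1 * \int[P]_om (`|Gface w I (sf t om)| *
    (1 - cutoff n.+1 (sf t om))) < 1.
  by near: n; exact: uniformly_integrable_cutoff.
have := @vague_cutoff _ _ _ _ _ X I r nu vague (fun=> B) n (@cst_continuous _ _ B).
move=> /cvgrPdist_lt/(_ 1 ltr01) tG.
set c := \int[nu]_(x in _) _ in tG.
have c0 : 0 <= c by apply: Rintegral_ge0 => x _; rewrite mulr_ge0 ?cutoff_ge0.
(* The cutoff part is eventually at most [c + 1], since its bound tends to [c], and the remainder is
   at most 1. *)
exists (c + 2); first by rewrite ltr_wpDl.
near=> t.
have rt : 0 < r t by near: t.
rewrite -ler_pdivrMr// mulrC /mean_absG fine_expectation.
have -> : \int[P]_om `|Gface w I (sf t om)| =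
    \int[P]_om (`|Gface w I (sf t om)| * cutoff n.+1 (sf t om)) +
    \int[P]_om (`|Gface w I (sf t om)| * (1 - cutoff n.+1 (sf t om))).
  rewrite -RintegralD//.
  - by apply: eq_Rintegral => om _; rewrite -mulrDr addrC subrK mulr1.
  - exact: (@integrable_absGface_scaled _ _ _ _ _ _ _ _ (cutoff n.+1)).
  - exact: (@integrable_absGface_scaled _ _ _ _ _ _ _ _
      (fun x => 1 - cutoff n.+1 x)).
rewrite mulrDr (_ : c + 2 = c + 1 + 1); last by ring.
apply: lerD; last by apply: ltW; near: t.
apply: (@le_trans _ _ ((r t)^-1 * \int[P]_om (B * cutoff n.+1 (sf t om)))).
  rewrite ler_wpM2l ?invr_ge0 ?(ltW rt)//; apply: le_Rintegral => //.
  - exact: (@integrable_absGface_scaled _ _ _ _ _ _ _ _ (cutoff n.+1)).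
  - apply: (@bounded_integrable _ _ _ _ _ B).
      by apply: measurable_funM => //; exact: mcutoffX.
    by move=> om; rewrite normrM !ger0_norm ?cutoff_ge0// ler_piMr ?cutoff_le1.
  - by move=> om _; rewrite ler_wpM2r ?cutoff_ge0.
have : `|c - (r t)^-1 * \int[P]_om (B * cutoff n.+1 (sf t om))| < 1 by near: t.
by rewrite distrC => /ltr_distlDr/ltW; rewrite addrC.
Unshelve. all: by end_near. Qed.

Lemma transfer_absG_eqo (s : R -> R) :
  r =o_ (+oo_ R) s -> mean_absG w X I =o_ (+oo_ R) s.
Proof.
have [[r0 _ _] _ _ _ _] := hyps.
have [C C0 leC] := transfer_absG_bigO.
move=> /eqoP rs; apply/eqoP => e e0.
have eC : 0 < e / C by rewrite divr_gt0.
near=> t.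
have rt : 0 < r t by near: t.
have absG0 : 0 <= mean_absG w X I t.
  by rewrite /mean_absG fine_expectation; exact: Rintegral_ge0.
rewrite ger0_norm//; apply: (@le_trans _ _ (C * r t)); first by near: t.
have : `|r t| <= e / C * `|s t| by near: t; exact: rs.
by rewrite gtr0_norm// mulrAC ler_pdivlMr// mulrC.
Unshelve. all: by end_near. Qed.

End face_transfer.

(** * Face decomposition and tail expansion *)

Section face_decomposition.
Context {R : realType} {m : nat}.

(** The orthogonality relation of Moebius inversion on the lattice of subsets. *)
Lemma sum_superset_sign (J : {set 'I_m}) :
  \sum_(I : {set 'I_m} | J \subset I) (-1) ^+ (#|I| - #|J|) =
  (J == [set: 'I_m]%SET)%:R :> R.
Proof.
have [->|/eqP JT] := eqVneq J [set: 'I_m]%SET.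
  rewrite (big_pred1 [set: 'I_m]%SET) ?subnn// => I.
  by rewrite finset.subTset eq_sym.
have [i0 i0J] : exists i0, i0 \notin J.
  apply/existsP; rewrite -negb_forall; apply/negP => /forallP JA; apply: JT.
  by apply/setP => i; rewrite JA !inE.
(* Toggling the membership of i0 changes the sign of every term. *)
pose h (I : {set 'I_m}) := if i0 \in I then (I :\ i0)%SET else (i0 |: I)%SET.
have hK : involutive h.
  move=> I; rewrite /h; have [iI|iI] := boolP (i0 \in I).
    by rewrite in_setD1 eqxx/= finset.setD1K.
  by rewrite in_setU1 eqxx/= finset.setU1K.
have hsub I : (J \subset h I) = (J \subset I).
  rewrite /h; have [iI|iI] := boolP (i0 \in I).
    by rewrite finset.subsetD1 i0J andbT.
  apply/idP/idP => [JI|]; last by move=> /fintype.subset_trans; apply; exact: finset.subsetUr.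
  apply/fintype.subsetP => i iJ; have := fintype.subsetP JI _ iJ.
  by rewrite !inE => /orP[/eqP ii0|//]; rewrite -ii0 iJ in i0J.
set s := \sum_(_ | _) _.
suff : s = - s by move=> /eqP; rewrite -addr_eq0 -mulr2n mulrn_eq0/= => /eqP.
rewrite {1}/s (reindex_inj (inv_inj hK)) /s -sumrN.
apply: eq_big => [I|I JI]; first exact: hsub.
rewrite hsub in JI; rewrite /h; have [iI|iI] := boolP (i0 \in I).
  have JI' : J \subset (I :\ i0)%SET by rewrite finset.subsetD1 JI.
  rewrite [in RHS](cardsD1 i0 I) iI add1n subSn ?subset_leq_card//.
  by rewrite exprS mulN1r opprK.
by rewrite cardsU1 iI add1n subSn ?subset_leq_card// exprS mulN1r.
Qed.

(** After exchanging the sums, each [g J] is multiplied by the sum of the signs over the supersets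
    of [J], which vanishes unless [J] is the full set. The empty face contributes 0 and may be added
    freely. *)
Lemma face_decomposition (w x : 'I_m -> R) :
  ((1 < \sum_(i < m) w i * x i)%R%:R : R) =
  \sum_(I : {set 'I_m} | (0 < #|I|)%N) Gface w I (face I x).
Proof.
pose g (J : {set 'I_m}) : R := (1 < \sum_(i in J) w i * x i)%R%:R.
have GE I : Gface w I (face I x) =
    \sum_(J : {set 'I_m} | J \subset I) (-1) ^+ (#|I| - #|J|) * g J.
  by apply: eq_bigr => J JI; rewrite gface_extend0_face.
have G0 : Gface w finset.set0 (face finset.set0 x) = 0.
  rewrite GE (big_pred1 finset.set0) => [|J]; last by rewrite finset.subset0.
  by rewrite /g big_set0 ltr10 mulr0.
have -> : \sum_(I : {set 'I_m} | (0 < #|I|)%N) Gface w I (face I x) =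
    \sum_(I : {set 'I_m}) Gface w I (face I x).
  rewrite [RHS](bigD1 finset.set0)//= G0 add0r.
  by apply: eq_bigl => I; rewrite card_gt0.
rewrite [RHS](eq_bigr _ (fun I _ => GE I)) (exchange_big_dep predT)//=.
under [RHS]eq_bigr do rewrite -mulr_suml sum_superset_sign.
rewrite [RHS](bigD1 [set: 'I_m]%SET)//= eqxx mul1r [X in _ + X]big1; last first.
  by move=> J /negbTE JT; rewrite JT mul0r.
rewrite addr0 /g; congr (nat_of_bool (_ < _))%:R.
by apply: eq_bigl => i; rewrite !inE.
Qed.

Lemma big_card1 (F : {set 'I_m} -> R) :
  \sum_(I : {set 'I_m} | #|I| == 1%N) F I = \sum_(i < m) F [set i]%SET.
Proof.
rewrite -(big_imset F (A := predT) (h := fun i => [set i]%SET)); last first.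
  by move=> i j _ _ /set1_inj.
apply: eq_bigl => I; apply/cards1P/imsetP => [[i ->]|[i _ ->]]; by exists i.
Qed.

End face_decomposition.

Lemma Rintegral_sum {R : realType} d {T : measurableType d}
    (mu : {measure set T -> \bar R}) (D : set T) (J : Type) (s : seq J)
    (Q : pred J) (f : J -> T -> R) : measurable D ->
  (forall j, mu.-integrable D (EFin \o f j)) ->
  \int[mu]_(x in D) (\sum_(j <- s | Q j) f j x) =
  \sum_(j <- s | Q j) \int[mu]_(x in D) f j x.
Proof.
move=> mD fi.
rewrite /Rintegral; under eq_integral do rewrite -sumEFin.
rewrite integral_sum//.
by rewrite -sum_fine// => j _; exact: (integrable_fin_num mD (fi j)).
Qed.

(** * Integration of the face decomposition *)

Section tail_expansion.
Context {R : realType} {m : nat} {d : measure_display} {T : measurableType d}.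
Context {P : probability T R} (w : 'I_m -> R) (X : 'I_m -> {RV P >-> R}).

Lemma mean_GE (I : {set 'I_m}) t :
  mean_G w X I t = \int[P]_om Gface w I (scaled_face X I t om).
Proof. exact: fine_expectation. Qed.

Lemma fine_probability_gt (Y : T -> R) (t : R) :
  measurable_fun setT Y -> 0 < t ->
  fine (P [set om | t < Y om]) = \int[P]_om (1 < Y om / t)%R%:R.
Proof.
move=> mY t0.
have mA : measurable [set om | t < Y om].
  have -> : [set om | t < Y om] = Y @^-1` `]t, +oo[.
    by apply/seteqP; split => om; rewrite /= in_itv/= andbT.
  by rewrite -[X in measurable X]setTI; exact: mY.
rewrite /Rintegral -[X in P X]setIT -integral_indic//.
congr fine; apply: eq_integral => om _; rewrite indicE.
congr (nat_of_bool _)%:R%:E; rewrite ltr_pdivlMr// mul1r.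
by apply/idP/idP; rewrite inE.
Qed.

Lemma measurable_weighted_sum (Q : pred 'I_m) :
  measurable_fun setT (fun om => \sum_(i | Q i) w i * X i om).
Proof.
under eq_fun do rewrite big_mkcond.
apply: measurable_sum => i; case: (Q i) => //.
exact: measurable_funM.
Qed.

(** A singleton has only itself and the empty set as subsets, and the empty set contributes 0. *)
Lemma mean_G_set1 (i : 'I_m) t : 0 < t ->
  mean_G w X [set i]%SET t = fine (P [set om | t < w i * X i om]).
Proof.
move=> t0; rewrite fine_probability_gt//; last exact: measurable_funM.
rewrite mean_GE; apply: eq_Rintegral => om _.
rewrite /Gface (bigD1 [set i]%SET)//= (big_pred1 finset.set0); last first.
  move=> J; rewrite finset.subset1 /=.
  have [->|J0] := eqVneq J finset.set0; last by rewrite orbF andbN.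
  by rewrite orbT/=; apply/eqP => /setP/(_ i); rewrite !inE eqxx.
rewrite !gface_extend0_face ?finset.sub0set// big_set0 big_set1 ltr10 mulr0 addr0.
by rewrite subnn expr0 mul1r mulrA.
Qed.

(** The face decomposition is integrated at [X / t]; the singleton faces yield the marginal
    tails. *)
Lemma tail_face_expansion t : 0 < t ->
  fine (P [set om | t < \sum_(i < m) w i * X i om]) =
  \sum_(i < m) fine (P [set om | t < w i * X i om]) +
  \sum_(I : {set 'I_m} | (2 <= #|I|)%N) mean_G w X I t.
Proof.
move=> t0; rewrite fine_probability_gt//; last exact: (measurable_weighted_sum predT).
have -> : \int[P]_om (1 < (\sum_(i < m) w i * X i om) / t)%R%:R =
    \int[P]_om \sum_(I : {set 'I_m} | (0 < #|I|)%N) Gface w I (scaled_face X I t om).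
  apply: eq_Rintegral => om _; rewrite mulr_suml.
  under eq_bigr do rewrite -mulrA.
  exact: face_decomposition.
rewrite Rintegral_sum//; last by move=> I; exact: integrable_Gface_scaled.
rewrite (bigID (fun I : {set 'I_m} => #|I| == 1%N))/=; congr (_ + _).
  transitivity (\sum_(I : {set 'I_m} | #|I| == 1%N) mean_G w X I t).
    by apply: eq_big => [I|I _]; [case: #|I| => [|[]]|rewrite mean_GE].
  by rewrite big_card1; apply: eq_bigr => i _; exact: mean_G_set1.
by apply: eq_big => [I|I _]; [case: #|I| => [|[]]|rewrite mean_GE].
Qed.

Lemma retained_expansion (Ret : {set {set 'I_m}}) (r : R -> R)
    (l : {set 'I_m} -> R -> R) :
  (forall I, I \in Ret -> (2 <= #|I|)%N) ->
  (forall I, I \in Ret -> mean_G w X I = l I +o_ (+oo_ R) r) ->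
  (forall I : {set 'I_m}, (2 <= #|I|)%N -> I \notin Ret ->
     mean_absG w X I =o_ (+oo_ R) r) ->
  (fun t : R => fine (P [set om | t < \sum_(i < m) w i * X i om])) =
  (fun t : R => \sum_(i < m) fine (P [set om | t < w i * X i om]) +
     \sum_(I in Ret) l I t) +o_ (+oo_ R) r.
Proof.
move=> Ret2 kept omitted; apply/eqaddoP => e e0.
pose N := #|[set: {set 'I_m}]%SET|.
(* Omitted faces get main term 0, so that one sum collects all errors. Each gets the share
   [e / N.+1], where [N] counts all subsets and so bounds the number of faces. *)
pose err (I : {set 'I_m}) t := mean_G w X I t - (if I \in Ret then l I t else 0).
have eN : 0 < e / N.+1%:R by rewrite divr_gt0.
have errI (I : {set 'I_m}) : \forall t \near +oo,
    (2 <= #|I|)%N -> `|err I t| <= e / N.+1%:R * `|r t|.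
  have [I2|_] := boolP (2 <= #|I|)%N; last by near=> t.
  rewrite /err; have [IR|IR] := boolP (I \in Ret).
    have /eqaddoP/(_ _ eN) := kept I IR.
    by apply: filterS => t le_e _; exact: le_e.
  have /eqoP/(_ _ eN) := omitted I I2 IR.
  apply: filterS => t le_e _; apply: le_trans le_e.
  rewrite subr0 mean_GE /mean_absG fine_expectation.
  have iG := @integrable_Gface_scaled _ _ _ _ P w X I t.
  by apply: le_trans (le_normr_Rintegral _ iG) _ => //; exact: ler_norm.
(* There are finitely many faces, so a single threshold for [t] serves them all. *)
have errs := @filter_forall _ _ (fun (I : {set 'I_m}) t =>
  (2 <= #|I|)%N -> `|err I t| <= e / N.+1%:R * `|r t|) _ _ errI.
near=> t.
have t0 : 0 < t by [].
have -> : ((fun t : R => fine (P [set om | t < \sum_(i < m) w i * X i om])) -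
    (fun t : R => \sum_(i < m) fine (P [set om | t < w i * X i om]) +
     \sum_(I in Ret) l I t)) t = \sum_(I : {set 'I_m} | (2 <= #|I|)%N) err I t.
  transitivity (fine (P [set om | t < \sum_(i < m) w i * X i om]) -
    (\sum_(i < m) fine (P [set om | t < w i * X i om]) + \sum_(I in Ret) l I t)) => //.
  rewrite tail_face_expansion// opprD addrACA subrr add0r /err sumrB.
  congr (_ - _); rewrite -big_mkcondr; apply: eq_bigl => I.
  by apply/idP/andP => [IR|[]//]; split => //; exact: Ret2.
apply: le_trans (ler_norm_sum _ _ _) _.
apply: (@le_trans _ _ (\sum_(I : {set 'I_m}) e / N.+1%:R * `|r t|)).
  rewrite [leLHS]big_mkcond; apply: ler_sum => I _; case: ifP => [I2|_].
    by move: I2; move: I; near: t; exact: errs.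
  by rewrite mulr_ge0// ltW.
rewrite sumr_const -[leLHS]mulr_natr mulrAC ler_wpM2r//.
rewrite -mulrA ler_piMr ?(ltW e0)// ler_pdivrMl// mulr1 ler_nat.
by rewrite /N cardsT leqW.
Unshelve. all: by end_near. Qed.

End tail_expansion.

(** * Insufficiency of the nominal scale *)

Section nominal_scale_insufficient.
Context {R : realType}.

Lemma decreases_to0_expR (c : R) : 0 < c ->
  decreases_to0 (fun t => expR (- (c * t))).
Proof.
move=> c0; split.
- by apply: nearW => t; exact: expR_gt0.
- by apply: nearW => s t st; rewrite ler_expR lerN2 ler_pM2l.
- apply: (@cvg_comp _ _ _ (fun t => c * t) (fun x => expR (- x)) _ +oo _ _
    (@cvgr_expR R)).
  exact: gt0_cvgMry.
Qed.

(* The probability structure of [exponential_prob 1] depends on a proof of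
   [0 < 1], so it has to be named explicitly. *)
Let expo := exponential_distribution_exponential_prob__canonical__probability_measure_Probability
  (@ltr01 R).

(** Obtained by additivity from the known values on the intervals from 0 to [a] and from 0 to
    [a + 1]. *)
Lemma exponential_prob_itvoc (a : R) : 0 < a ->
  fine (exponential_prob 1 `]a, (a + 1)]%classic) = expR (- a) * (1 - expR (- 1)).
Proof.
move=> a0; have ab : a < a + 1 by rewrite ltrDl.
have a10 : 0 < a + 1 by rewrite addr_gt0.
have Ea : expo `[0, a]%classic = (1 - expR (- a))%:E.
  by rewrite /= exponential_prob_itv0c// mulN1r -EFinB.
have Ea1 : expo `[0, (a + 1)]%classic = (1 - expR (- a) * expR (- 1))%:E.
  by rewrite /= exponential_prob_itv0c// mulN1r -EFinB opprD expRD.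
have itvU : `[0, (a + 1)]%classic = `[0, a]%classic `|` `]a, (a + 1)]%classic.
  by rewrite -itv_bndbnd_setU// bnd_simp ltW.
pose B : set R := `]a, (a + 1)]%classic.
have : (1 - expR (- a) * expR (- 1))%:E = ((1 - expR (- a))%:E + expo B)%E.
  rewrite -Ea1 -Ea itvU; apply: measureU.
  - exact: measurable_itv.
  - exact: measurable_itv.
  - apply/seteqP; split => // x [] /=; rewrite !in_itv/=.
    by move=> /andP[_ xa] /andP[/lt_le_trans/(_ xa)]; rewrite ltxx.
rewrite -/B; have : (expo B \is a fin_num)%E.
  by apply: fin_num_measure; exact: measurable_itv.
rewrite /=; case: (exponential_prob 1 _) => //= p _ h.
have {}h : 1 - expR (- a) * expR (- 1) = 1 - expR (- a) + p by case: h.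
by apply: (addrI (1 - expR (- a))); rewrite -h; ring.
Qed.

(** The contracted [i]-th coordinates of [K] form a compact, hence closed, set of positive reals, so
    a neighbourhood of 0 misses it. *)
Lemma compact_posvec_contract_ge {m : nat} {I : {set 'I_m}}
    (K : set (extvec R I)) (i : {i | i \in I}) : compact K -> K `<=` posvec R I ->
  exists2 e : R, 0 < e & forall x, K x -> e <= contract (x i).
Proof.
move=> cK Kpos.
pose c (x : extvec R I) := contract (x i).
have cc : compact (c @` K).
  apply: continuous_compact => //; apply: continuous_subspaceT.
  exact: contract_proj_continuous.
have : nbhs (0 : R) (~` (c @` K)).
  apply: open_nbhs_nbhs; split.
    by apply: closed_openC; apply: compact_closed => //; exact: Rhausdorff.
  move=> [x Kx cx0]; have := Kpos x Kx i.
  by rewrite -lt_contract contract0 -cx0 ltxx.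
move=> /nbhs_ballP[e /= e0 eK]; exists e => // x Kx.
rewrite leNgt; apply/negP => cxe; apply: (eK (c x)); last by exists x.
have := Kpos x Kx i; rewrite -lt_contract contract0 => c0.
by rewrite /ball/= sub0r normrN gtr0_norm.
Qed.

Context {m : nat} (I : {set 'I_m}).
Hypothesis I2 : (2 <= #|I|)%N.

Definition uniform_weight (i : 'I_m) : R := if i \in I then #|I|%:R^-1 else 0.

Let cardI_gt0 : 0 < #|I|%:R :> R.
Proof. by rewrite ltr0n (leq_trans _ I2). Qed.

Lemma simplex_uniform_weight : simplex_weight uniform_weight.
Proof.
split=> [i|]; first by rewrite /uniform_weight; case: ifP; rewrite ?invr_ge0.
rewrite /uniform_weight -big_mkcond sumr_const -[LHS]mulr_natr mulVf//.
by rewrite gt_eqF.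
Qed.

Context (i0 : 'I_m).
Hypothesis i0I : i0 \in I.

(** The exponential law lives on the whole line, while nonnegativity is required at every sample
    point; hence the maximum with 0. *)
Let Xfun (i : 'I_m) (om : R) : R := if i == i0 then Num.max om 0 else 1.

Let measurable_Xfun i : measurable_fun setT (Xfun i).
Proof.
rewrite /Xfun; case: (i == i0) => //.
by apply: measurable_maxr => //; exact: measurable_id.
Qed.

Let X (i : 'I_m) : {RV expo >-> R} :=
  @mfun_Sub _ _ (measurableTypeR R) R (Xfun i) (mem_set (measurable_Xfun i)).

Lemma spike_vague (rI : R -> R) : vague_transfer X rI (@mzero _ (borel_extvec R I) R).
Proof.
move=> f cf [K [cK Kpos fK]].
rewrite [X in _ --> X](_ : _ = 0); last first.
  by rewrite /Rintegral integral_measure_zero.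
(* A second index exists because [I] has at least two elements; its scaled coordinate [1 / t]
   eventually leaves [K]. *)
have [i1 i1I i10] : exists2 i1, i1 \in I & i1 != i0.
  have : (0 < #|(I :\ i0)%SET|)%N by move: I2; rewrite (cardsD1 i0) i0I add1n ltnS.
  by rewrite card_gt0 => /set0Pn[i1]; rewrite !inE => /andP[]; exists i1.
have [e e0 eK] := @compact_posvec_contract_ge m I K (exist _ i1 i1I) cK Kpos.
apply: cvg_near_cst; near=> t.
have t0 : 0 < t by [].
rewrite fine_expectation (_ : \int[_]_om _ = 0) ?mulr0//.
(* This turns the right-hand side into [fine 0], so that it remains to annihilate the integral
   inside [fine] on the left. *)
rewrite -[RHS](Rintegral_set0 expo (fun=> 0)) /Rintegral integral_set0.
rewrite integral0_eq// => om _; rewrite fK// => /eK.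
rewrite /scaled_face /face /= /Xfun (negbTE i10).
apply/negP; rewrite -ltNge div1r.
(* The contraction of a positive real is at most that real. *)
apply: (@le_lt_trans _ _ t^-1).
  have t1 : 1 <= 1 + `|t^-1| by rewrite lerDl.
  by rewrite ler_piMr ?invr_ge0 ?(ltW t0)// invf_le1 ?(lt_le_trans _ t1).
rewrite invf_plt ?posrE//; near: t; apply: nbhs_pinfty_gt.
exact: num_real.
Unshelve. all: by end_near. Qed.

(* There X_i0 / t plus the other coordinates exceeds #|I|, but stops doing so
   when any coordinate is dropped. *)
Let spike t : set R :=
  `](#|I|%:R * t - #|I|%:R + 1), (#|I|%:R * t - #|I|%:R + 1 + 1)]%classic.

Lemma spike_Gface t om : 1 <= t -> spike t om ->
  Gface uniform_weight I (scaled_face X I t om) = 1.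
Proof.
move=> t1; rewrite /spike/= in_itv/= => /andP[lo hi].
have t0 : 0 < t by apply: lt_le_trans t1.
have Nt : #|I|%:R <= #|I|%:R * t by rewrite ler_pMr.
have om0 : 0 < om by apply: lt_trans lo; rewrite ltr_wpDl// subr_ge0.
have gE (J : {set 'I_m}) : J \subset I ->
    gface uniform_weight J (extend0 (face I (fun i => X i om / t))) = (J == I)%:R.
  move=> JI; rewrite gface_extend0_face//; congr (nat_of_bool _)%:R.
  have -> : \sum_(i in J) uniform_weight i * (X i om / t) =
      (\sum_(i in J) Xfun i om) / (#|I|%:R * t).
    rewrite mulr_suml; apply: eq_bigr => i iJ.
    by rewrite /uniform_weight (fintype.subsetP JI)// invfM mulrCA mulrA.
  rewrite ltr_pdivlMr ?mulr_gt0// mul1r.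
  have sum1 (A : {set 'I_m}) : i0 \notin A -> \sum_(i in A) Xfun i om = #|A|%:R.
    move=> i0A; rewrite (eq_bigr (fun=> 1)) ?sumr_const// => i iA.
    by rewrite /Xfun; case: eqVneq => // ii0; rewrite -ii0 iA in i0A.
  (* Without [i0] the sum is [#|J|], which is at most [#|I| * t] because [t >= 1]. *)
  have [i0J|i0J] := boolP (i0 \in J); last first.
    rewrite sum1//; have -> : (J == I) = false.
      by apply/negbTE/eqP => JE; rewrite JE i0I in i0J.
    apply/negbTE; rewrite -leNgt (le_trans _ Nt)// ler_nat.
    exact: subset_leq_card.
  rewrite (bigD1 i0)//= {1}/Xfun eqxx max_l ?ltW//.
  have -> : \sum_(i in J | i != i0) Xfun i om = #|J|%:R - 1.
    transitivity (\sum_(i in (J :\ i0)%SET) Xfun i om).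
      by apply: eq_bigl => i; rewrite !inE andbC.
    rewrite sum1; last by rewrite !inE eqxx.
    by rewrite (cardsD1 i0 J) i0J natrD addrC addKr.
  (* For [J = I] the left end of [spike t] pushes the sum above [#|I| * t]; if an index other than
     [i0] is missing, the right end keeps it at or below that value. *)
  have [->|JnI] := eqVneq J I; first by lra.
  have : (#|J| < #|I|)%N by rewrite proper_card// finset.properEneq JnI.
  rewrite -(ler_nat R) -natr1 => h; apply/negbTE; rewrite -leNgt.
  by move: hi h; move: (#|I|%:R * t) (#|I|%:R) (#|J|%:R) => a b c hi h; lra.
rewrite /Gface (bigD1 I)//= {1}/scaled_face gE// eqxx subnn expr0 mulr1.
rewrite big1 ?addr0// => J /andP[JI /negbTE JnI].
by rewrite /scaled_face gE// JnI mulr0.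
Qed.

(** The mean is at least the probability of [spike t], whose left end is at most [#|I| * t]. *)
Lemma spike_mean_absG t : 1 <= t ->
  expR (- (#|I|%:R * t)) * (1 - expR (- 1)) <= mean_absG uniform_weight X I t.
Proof.
move=> t1; have Nt : #|I|%:R <= #|I|%:R * t by rewrite ler_pMr.
have N1 : 1 <= #|I|%:R :> R by rewrite ler1n (leq_trans _ I2).
have a0 : 0 < #|I|%:R * t - #|I|%:R + 1 by rewrite ltr_wpDl// subr_ge0.
apply: (@le_trans _ _ (fine (expo (spike t)))).
  have e1 : 0 <= 1 - expR (- 1) :> R.
    by rewrite subr_ge0 -[leRHS]expR0 ler_expR lerN10.
  rewrite [leRHS](exponential_prob_itvoc a0) (ler_wpM2r e1)//.
  by rewrite ler_expR lerN2; move: N1; move: (#|I|%:R * t) (#|I|%:R) => a b; lra.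
have mspike : measurable (spike t) by exact: measurable_itv.
rewrite -[spike t]setIT -integral_indic// /mean_absG fine_expectation.
apply: (@le_Rintegral _ _ _ expo setT \1_(spike t)) => //.
- exact: integrable_indic.
- have := @integrable_absGface_scaled _ _ _ _ expo uniform_weight X I (fun=> 1) t.
  under [X in _ -> _ -> is_true (integrable _ _ X)]eq_fun do rewrite /= mulr1.
  by apply => // x; rewrite ler01 lexx.
- move=> om _; rewrite indicE; have [/set_mem oms|_] := boolP (om \in _); last first.
    exact: normr_ge0.
  by rewrite spike_Gface// normr1.
Qed.

Lemma spike_not_eqo : ~ (mean_absG uniform_weight X I =o_ (+oo_ R)
  (fun t => expR (- (#|I|%:R * t)))).
Proof.
have c0 : 0 < 1 - expR (- 1) :> R by rewrite subr_gt0 -[ltRHS]expR0 ltr_expR ltrN10.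
move=> /eqoP/(_ ((1 - expR (- 1)) / 2)) => /(_ (divr_gt0 c0 (ltr0n _ 2))) small.
near +oo_R => t.
have t1 : 1 <= t by [].
have : `|mean_absG uniform_weight X I t| <=
  (1 - expR (- 1)) / 2 * `|expR (- (#|I|%:R * t))| by near: t.
apply/negP; rewrite -ltNge (gtr0_norm (expR_gt0 _)).
apply: lt_le_trans (ler_norm _); apply: lt_le_trans (spike_mean_absG t1).
rewrite mulrC ltr_pM2l ?expR_gt0// ltr_pdivrMr// ltr_pMr//.
by rewrite ltr1n.
Unshelve. all: by end_near. Qed.

(** The quotient of the two functions is again [expR (- (c * t))], which tends to 0. *)
Lemma expR_littleo (c : R) : 0 < c ->
  (fun t => expR (- ((c + c) * t))) =o_ (+oo_ R) (fun t => expR (- (c * t))).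
Proof.
move=> c0; apply/eqoP => e e0; have [_ _] := decreases_to0_expR c0.
move=> /cvgrPdist_le/(_ e e0); apply: filterS => t.
rewrite sub0r normrN mulrDl opprD expRD normrM => h.
by rewrite ler_wpM2r.
Qed.

Lemma nominal_scale_insufficient :
  exists (w : 'I_m -> R) (d : measure_display) (T : measurableType d)
      (P : probability T R) (X : 'I_m -> {RV P >-> R}) (r rI : R -> R)
      (nuI : {measure set (borel_extvec R I) -> \bar R}),
    [/\ simplex_weight w /\ (forall i om, 0 <= X i om),
        decreases_to0 r /\ decreases_to0 rI,
        radon_posvec nuI /\ vague_transfer X rI nuI,
        rI =o_ (+oo_ R) r
      & ~ (mean_absG w X I =o_ (+oo_ R) r)].
Proof.
exists uniform_weight, _, _, expo, X, (fun t => expR (- (#|I|%:R * t))).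
(* The target rate [r] is the exponential in the lower bound for the mean of [|Gface|], and the
   nominal rate is its square; the zero limit measure is correct at every rate. *)
exists (fun t => expR (- ((#|I|%:R + #|I|%:R) * t))), mzero; split.
- split; first exact: simplex_uniform_weight.
  by move=> i om; rewrite /= /Xfun; case: ifP; rewrite // le_max lexx orbT.
- by split; apply: decreases_to0_expR => //; exact: addr_gt0.
- by split; [move=> K _ _; rewrite /mzero ltry|exact: spike_vague].
- exact: expR_littleo.
- exact: spike_not_eqo.
Qed.

End nominal_scale_insufficient.

Theorem mainTheorem4 (R : realType) (m : nat) :
  (forall (w : 'I_m -> R) (d : measure_display) (T : measurableType d)
      (P : probability T R) (X : 'I_m -> {RV P >-> R}),
    simplex_weight w ->
    (forall i om, 0 <= X i om) ->
    [/\ forall (I : {set 'I_m}) (rI : R -> R)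
            (nuI : {measure set (borel_extvec R I) -> \bar R}),
          (2 <= #|I|)%N ->
          transfer_hyps w X rI nuI ->
          mean_G w X I =
            (fun t : R => rI t * \int[nuI]_(x in posvec R I) Gface w I x)
            +o_ (+oo_ R) rI,
        forall x : 'I_m -> R,
          (forall i, 0 <= x i) ->
          ((1 < \sum_(i < m) w i * x i)%R%:R : R) =
            \sum_(I : {set 'I_m} | (0 < #|I|)%N) Gface w I (face I x),
        forall (Ret : {set {set 'I_m}}) (r : R -> R)
            (rI : {set 'I_m} -> R -> R)
            (nuI : forall I : {set 'I_m},
                     {measure set (borel_extvec R I) -> \bar R}),
          (forall I : {set 'I_m}, I \in Ret -> (2 <= #|I|)%N) ->
          (forall I : {set 'I_m}, I \in Ret ->
             transfer_hyps w X (rI I) (nuI I) /\ rI I =O_ (+oo_ R) r) ->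
          (forall I : {set 'I_m}, (2 <= #|I|)%N -> I \notin Ret ->
             mean_absG w X I =o_ (+oo_ R) r) ->
          (fun t : R => fine (P [set om | t < \sum_(i < m) w i * X i om])) =
            (fun t : R =>
               \sum_(i < m) fine (P [set om | t < w i * X i om]) +
               \sum_(I in Ret)
                 rI I t * \int[nuI I]_(x in posvec R I) Gface w I x)
            +o_ (+oo_ R) r
      & forall (I : {set 'I_m}) (r rI : R -> R)
            (nuI : {measure set (borel_extvec R I) -> \bar R}),
          (2 <= #|I|)%N ->
          transfer_hyps w X rI nuI ->
          rI =o_ (+oo_ R) r ->
          mean_absG w X I =o_ (+oo_ R) r]) /\
  (forall I : {set 'I_m}, (2 <= #|I|)%N ->
    exists (w : 'I_m -> R) (d : measure_display) (T : measurableType d)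
      (P : probability T R) (X : 'I_m -> {RV P >-> R}) (r rI : R -> R)
      (nuI : {measure set (borel_extvec R I) -> \bar R}),
      [/\ simplex_weight w /\ (forall i om, 0 <= X i om),
          decreases_to0 r /\ decreases_to0 rI,
          radon_posvec nuI /\ vague_transfer X rI nuI,
          rI =o_ (+oo_ R) r
        & ~ (mean_absG w X I =o_ (+oo_ R) r)]).
Proof.
split=> [w d T P X w_simplex X_ge0|I I2]; last first.
  have [i0 i0I] : exists i0, i0 \in I.
    by apply/set0Pn; rewrite -card_gt0 (leq_trans _ I2).
  exact: nominal_scale_insufficient I2 _ i0I.
split.
- by move=> I rI nuI _ hyps; exact: transfer_eqo.
- by move=> x _; exact: face_decomposition.
- move=> Ret r rI nuI Ret2 kept omitted.
  apply: retained_expansion => // I IR; have [hyps rIr] := kept I IR.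
  have /eqaddoP rest := transfer_eqo hyps.
  (* The transfer leaves an error negligible against [rI I]; with [rI I] at most [k] times [r], the
     tolerance [e / k] for the former becomes [e] for the latter. *)
  apply/eqaddoP => e e0; have /eqO_exP[k k0 rIk] := rIr.
  have ek : 0 < e / k by rewrite divr_gt0.
  have := rest _ ek; apply: filterS2 rIk => t rIt le_e.
  apply: le_trans le_e _.
  by rewrite mulrAC ler_pdivrMr// -mulrA ler_pM2l// mulrC.
- by move=> I r rI nuI _ hyps; exact: transfer_absG_eqo hyps _.
Qed.
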